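(* Let $d\in\mathbb{N}_+$. For any $n\in\mathbb{N}_+$ and any $f:[0,1]^d\to\mathbb{R}$ with modulus of regularity $\omega:[0,d]\to\mathbb{R}$, there exists a ReLU MLP $\Phi:\mathbb{R}^d\to\mathbb{R}$ with width at most $8d(n+1)^d$, depth at most $\lceil\log_2 d\rceil+5$, and no more than $18d(n+1)^d$ nonzero parameters such that $$\|f-\Phi\|_{L^\infty([0,1]^d)}\le\omega\left(\frac d{2n}\right).$$ Moreover, the function $\bar\omega:[0,\infty)\to[0,\infty)$ defined by $\bar\omega(x)=\omega(x)$ if $x\in[0,d]$ and $\bar\omega(x)=\omega(d)$ if $x>d$ is a modulus of regularity of $\Phi$ on $\mathbb{R}^d$.
   Context: Modulus of regularity: for $I=[0,\infty)$ or $I=[0,T]$, a function $\omega:I\to[0,\infty)$ with $\omega(0)=0$ that is monotone increasing (not necessarily strictly) and concave. It is a modulus of regularity of a function $g$ on $X\subseteq\mathbb{R}^d$ if $|g(\mathbf{x})-g(\mathbf{y})|\le\omega(\|\mathbf{x}-\mathbf{y}\|_1)$ for all $\mathbf{x},\mathbf{y}\in X$ ($\ell^1$ norm). $\|g\|_{L^\infty(\Omega)}=\inf\{C\ge0:|g|\le C\text{ almost everywhere on }\Omega\}$. ReLU MLP: a function $\Phi:\mathbb{R}^{d_1}\to\mathbb{R}^{d_{\Delta+1}}$ with a representation $\mathbf{x}^{(1)}=\mathbf{x}$, $\mathbf{x}^{(l+1)}=\operatorname{ReLU}(\mathbf{W}^{(l)}\mathbf{x}^{(l)}+\mathbf{b}^{(l)})$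 for $l=1,\dots,\Delta-1$ (ReLU$(t)=\max\{0,t\}$ applied componentwise), $\Phi(\mathbf{x})=\mathbf{W}^{(\Delta)}\mathbf{x}^{(\Delta)}+\mathbf{b}^{(\Delta)}$, where $\mathbf{W}^{(l)}\in\mathbb{R}^{d_{l+1}\times d_l}$ and $\mathbf{b}^{(l)}\in\mathbb{R}^{d_{l+1}}$. Its depth is $\Delta-1$ (number of hidden layers), its width is $\max_{2\le l\le\Delta}d_l$, and the number of nonzero parameters is the total number of nonzero entries of all $\mathbf{W}^{(l)},\mathbf{b}^{(l)}$. *)

(* Defs.v *)
From HB Require Import structures.
From mathcomp Require Import all_boot all_order all_algebra.
From mathcomp Require Import all_classical all_reals all_analysis.

Set Implicit Arguments.
Unset Strict Implicit.
Unset Printing Implicit Defensive.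

Import Order.TTheory GRing.Theory Num.Theory.

Local Open Scope classical_set_scope.
Local Open Scope ring_scope.

Definition norm1 (R : realType) (d : nat) (x : 'cV[R]_d) : R :=
  \sum_(i < d) `|x i ord0|.

Definition unit_cube (R : realType) (d : nat) : set 'cV[R]_d :=
  [set x | forall i : 'I_d, 0 <= x i ord0 <= 1].
Arguments unit_cube : clear implicits.

Definition concave_function (R : realType) (I : set R) (w : R -> R) : Prop :=
  convex_function (E := R^o) I (fun t => - w t).

(* A function on an interval I = [0, T] or [0, +oo) is represented by a total
   function on R of which only the values on I matter. *)
Record is_modulus (R : realType) (I : set R) (w : R -> R) : Prop := IsModulus {
  modulus0 : w 0 = 0;
  modulus_ge0 : forall t, I t -> 0 <= w t;
  modulus_mono : forall s t, I s -> I t -> s <= t -> w s <= w t;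
  modulus_concave : concave_function I w
}.

(* w, with domain I, is a modulus of regularity of g on X. *)
Definition modulus_of_regularity (R : realType) (d : nat) (I : set R)
    (w : R -> R) (X : set 'cV[R]_d) (g : 'cV[R]_d -> R) : Prop :=
  is_modulus I w /\
  forall x y, X x -> X y -> `|g x - g y| <= w (norm1 (x - y)).

Definition extend_modulus (R : realType) (T : R) (w : R -> R) : R -> R :=
  fun t => if t <= T then w t else w T.

Definition box (R : realType) (d : nat) (a b : 'cV[R]_d) : set 'cV[R]_d :=
  [set x | forall i : 'I_d, a i ord0 <= x i ord0 <= b i ord0].

(* The truncation at 0 gives an empty box volume 0.  (For d = 0 every box has
   volume 1, and lebesgue_outer is not an outer measure; only d > 0 is meant.) *)
Definition box_volume (R : realType) (d : nat) (a b : 'cV[R]_d) : R :=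
  \prod_(i < d) Num.max 0 (b i ord0 - a i ord0).

Definition lebesgue_outer (R : realType) (d : nat) (A : set 'cV[R]_d)
    : \bar R :=
  ereal_inf [set s | exists a b : nat -> 'cV[R]_d,
    A `<=` \bigcup_k box (a k) (b k) /\
    s = (\sum_(0 <= k <oo) (box_volume (a k) (b k))%:E)%E].

Definition ae_on (R : realType) (d : nat) (Omega : set 'cV[R]_d)
    (P : 'cV[R]_d -> Prop) : Prop :=
  lebesgue_outer (Omega `&` [set x | ~ P x]) = 0%E.

(* Valued in the extended reals: it is +oo when g is essentially unbounded. *)
Definition Linfty_norm (R : realType) (d : nat) (Omega : set 'cV[R]_d)
    (g : 'cV[R]_d -> R) : \bar R :=
  ereal_inf [set C%:E | C in [set C : R |
    0 <= C /\ ae_on Omega (fun x => `|g x| <= C)]].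

Definition relu (R : realType) (t : R) : R := Num.max 0 t.

(* [relu_mlp R m n] is the type of representations of ReLU MLPs from R^m to
   R^n; [Hidden W b _ N] feeds ReLU(W x + b) to the remaining layers N, and
   [Output W b] is the final affine layer.  Hidden layers are nonempty. *)
Inductive relu_mlp (R : realType) : nat -> nat -> Type :=
| Output m n (W : 'M[R]_(n, m)) (b : 'cV[R]_n) : relu_mlp R m n
| Hidden m k n (W : 'M[R]_(k, m)) (b : 'cV[R]_k) (k_gt0 : (0 < k)%N)
    (N : relu_mlp R k n) : relu_mlp R m n.

Fixpoint mlp_eval (R : realType) (m n : nat) (N : relu_mlp R m n)
    : 'cV[R]_m -> 'cV[R]_n :=
  match N in relu_mlp _ m n return 'cV[R]_m -> 'cV[R]_n with
  | Output _ _ W b => fun x => W *m x + b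
  | Hidden _ _ _ W b _ N' =>
      fun x => mlp_eval N' (map_mx (@relu R) (W *m x + b))
  end.

Fixpoint mlp_depth (R : realType) (m n : nat) (N : relu_mlp R m n) : nat :=
  match N with
  | Output _ _ _ _ => 0
  | Hidden _ _ _ _ _ _ N' => (mlp_depth N').+1
  end.

Fixpoint mlp_width (R : realType) (m n : nat) (N : relu_mlp R m n) : nat :=
  match N with
  | Output _ _ _ _ => 0
  | Hidden _ k _ _ _ _ N' => maxn k (mlp_width N')
  end.

Definition mx_nonzeros (R : realType) (p q : nat) (A : 'M[R]_(p, q)) : nat :=
  #|[set ij : 'I_p * 'I_q | A ij.1 ij.2 != 0]%SET|.

Fixpoint mlp_nonzeros (R : realType) (m n : nat) (N : relu_mlp R m n) : nat :=
  match N with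
  | Output _ _ W b => mx_nonzeros W + mx_nonzeros b
  | Hidden _ _ _ W b _ N' => mx_nonzeros W + mx_nonzeros b + mlp_nonzeros N'
  end.

(* The real-valued function of a network with one-dimensional output. *)
Definition mlp_fun (R : realType) (d : nat) (N : relu_mlp R d 1)
    : 'cV[R]_d -> R :=
  fun x => mlp_eval N x ord0 ord0.

(* Main.v *)
(** Let Psi be the continuous piecewise linear interpolant of f at the points
g/n, g in {0..n}^d, on the Kuhn (Freudenthal) triangulation.  Its nodal basis
function at g is relu(1 - max_k (n x_k - g_k)^+ - max_k (g_k - n x_k)^+), and
this is the probability that floor(n x + u) = g when a single u, uniform on
[0, 1], is added to all coordinates; hence Psi(x) = E f(floor(n x + u) / n).
Since E |floor(a + u) - floor(b + u)| = |a - b| and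
E |floor(a + u) - a| <= 1/2, Jensen's inequality for the concave w gives both
|Psi(x) - Psi(y)| <= w(|x - y|_1) and |f(x) - Psi(x)| <= w(d/(2n)).
The network is Psi composed with the clipping of R^d to the cube, a contraction
for the l^1 norm; the maxima are computed by binary trees of depth up_log 2 d,
so the total depth is up_log 2 d + 4. *)

Require Import Defs.
From mathcomp Require Import all_boot all_order all_algebra.
From mathcomp Require Import all_classical all_reals all_analysis.
From mathcomp Require Import zify ring lra.

Set Implicit Arguments.
Unset Strict Implicit.
Unset Printing Implicit Defensive.

Import Order.TTheory GRing.Theory Num.Theory.

Local Open Scope classical_set_scope.
Local Open Scope ring_scope.

Lemma relu_ge0 (R : realType) (t : R) : 0 <= relu t.
Proof. by rewrite /relu le_max lexx. Qed.

Lemma ge0_relu (R : realType) (t : R) : 0 <= t -> relu t = t.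
Proof. by move=> t0; rewrite /relu max_r. Qed.

Lemma le0_relu (R : realType) (t : R) : t <= 0 -> relu t = 0.
Proof. by move=> t0; rewrite /relu max_l. Qed.

(** * Networks indexed by finite types *)

Section Networks.
Variable R : realType.

Lemma mx_nonzerosE p q (A : 'M[R]_(p, q)) :
  mx_nonzeros A = (\sum_i \sum_j (A i j != 0%R))%N.
Proof.
rewrite /mx_nonzeros cardsE -sum1_card big_mkcond pair_bigA /=.
by apply: eq_bigr => ij _; rewrite unfold_in; case: (A _ _ != 0).
Qed.

(* Networks whose input coordinates are indexed by a finite type I through a
   bijection e; dp, wd and nz are upper bounds. *)
Definition realizes (m : nat) (I : finType) (e : 'I_m -> I)
    (F : (I -> R) -> R) (dp wd nz : nat) :=
  exists N : relu_mlp R m 1,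
    [/\ (mlp_depth N <= dp)%N, (mlp_width N <= wd)%N,
        (mlp_nonzeros N <= nz)%N
      & forall v, mlp_fun N (\col_k v (e k)) = F v].

Lemma realizes_linear (m : nat) (I : finType) (e : 'I_m -> I) (a : I -> R) :
  bijective e -> realizes e (fun v => \sum_i a i * v i) 0 0 #|I|.
Proof.
move=> eb; exists (Output (\row_k a (e k)) 0); split=> //=.
  rewrite !mx_nonzerosE !big_ord1 mxE eqxx addn0.
  rewrite -sum1_card (reindex e) /=; last exact: onW_bij.
  by apply: leq_sum => k _; rewrite leq_b1.
move=> v; rewrite /mlp_fun /= !mxE addr0 [RHS](reindex e) /=; last exact: onW_bij.
by apply: eq_bigr => k _; rewrite !mxE.
Qed.

(** A layer is given by sparse rows: [r j] lists the pairs (coefficient, input) of neuron [j], and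
    coefficients of a repeated input are summed. The length of the list therefore bounds the nonzero
    entries of the row. *)
Lemma realizes_hidden (m : nat) (I J : finType) (e : 'I_m -> I)
    (r : J -> seq (R * I)) (b : J -> R) (F : (J -> R) -> R) (dp wd nz : nat) :
  bijective e -> (0 < #|J|)%N ->
  realizes (fun k : 'I_#|J| => enum_val k) F dp wd nz ->
  realizes e (fun v => F (fun j => relu (\sum_(c <- r j) c.1 * v c.2 + b j)))
    dp.+1 (maxn #|J| wd) (\sum_j (size (r j) + (b j != 0%R)) + nz).
Proof.
move=> eb J0 [N [Nd Nw Nn NF]].
pose W := \matrix_(k < #|J|, l < m)
  \sum_(c <- r (enum_val k) | c.2 == e l) c.1.
pose B := \col_(k < #|J|) b (enum_val k).
have vb : bijective (fun k : 'I_#|J| => enum_val k) by exact: enum_val_bij.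
exists (Hidden W B J0 N); split=> //=.
- by rewrite geq_max leq_max leqnn leq_max Nw orbT.
- apply: leq_add => //; rewrite !mx_nonzerosE -big_split /=.
  rewrite [leqRHS](reindex _ (onW_bij _ vb)) /=.
  apply: leq_sum => k _; rewrite big_ord1 !mxE leq_add2r.
  have -> : size (r (enum_val k)) =
      (\sum_(l < m) \sum_(c <- r (enum_val k) | c.2 == e l) 1)%N.
    rewrite (exchange_big_dep predT) //= -sum1_size.
    apply: eq_bigr => c _.
    transitivity (\sum_(i | c.2 == i) 1)%N.
      by rewrite (big_pred1 c.2) // => i; rewrite eq_sym.
    by rewrite (reindex e) //; exact: onW_bij.
  (* A column can be nonzero only if some pair of the list points to it. *)
  apply: leq_sum => l _; rewrite sum1_count.
  case: (boolP (has (fun c => c.2 == e l) (r (enum_val k)))) => h.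
    by rewrite (leq_trans (leq_b1 _)) // -has_count.
  by rewrite /W mxE big_hasC // eqxx.
- move=> v; rewrite -NF /mlp_fun /=; congr (mlp_eval N _ _ _).
  apply/matrixP => k l; rewrite !mxE; congr (relu (_ + _)).
  under [LHS]eq_bigr do rewrite /W !mxE mulr_suml.
  rewrite (exchange_big_dep predT) //=; apply: eq_bigr => c _.
  transitivity (\sum_(i | c.2 == i) c.1 * v i).
    by rewrite [RHS](reindex e) //; exact: onW_bij.
  by rewrite (big_pred1 c.2) // => i; rewrite eq_sym.
Qed.

Lemma realizes_weaken (m : nat) (I : finType) (e : 'I_m -> I) F
    dp wd nz dp' wd' nz' :
  (dp <= dp')%N -> (wd <= wd')%N -> (nz <= nz')%N ->
  realizes e F dp wd nz -> realizes e F dp' wd' nz'.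
Proof.
move=> hd hw hn [N [Nd Nw Nn NF]]; exists N.
by split=> //; [apply: leq_trans hd|apply: leq_trans hw|apply: leq_trans hn].
Qed.

Lemma sum_prod_bool (A : finType) (F : A * bool -> nat) :
  (\sum_a F a = \sum_a (F (a, true) + F (a, false)))%N.
Proof.
transitivity (\sum_a \sum_t F (a, t))%N.
  by rewrite pair_bigA; apply: eq_bigr => -[].
by apply: eq_bigr => a _; rewrite big_bool.
Qed.

(* For nonnegative a, max(a, b) = relu(a) + relu(b - a): one level of a binary
   tree computing a maximum, an unpaired last entry being passed on. *)
Lemma bigmax_pairs (m : nat) (s : 'I_m.+1 -> R) : (forall i, 0 <= s i) ->
  \big[Num.max/0]_(j < (m./2).+1)
     (relu (s (inord j.*2)) +
      relu (if (j.*2 < m)%N then s (inord j.*2.+1) - s (inord j.*2) else 0))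
  = \big[Num.max/0]_i s i.
Proof.
move=> s0; apply/le_anti/andP; split; apply/bigmax_leP; split.
- exact: bigmax_ge_id.
- move=> j _; rewrite ge0_relu //.
  case: ifP => _; last by rewrite le0_relu // addr0; exact: (le_bigmax 0 s).
  case: (lerP (s (inord j.*2.+1)) (s (inord j.*2))) => h.
    by rewrite le0_relu ?subr_le0 // addr0; exact: (le_bigmax 0 s).
  by rewrite ge0_relu ?subr_ge0 ?(ltW h) // addrC subrK; exact: (le_bigmax 0 s).
- exact: bigmax_ge_id.
- move=> i _.
  have ji : (i./2 < (m./2).+1)%N by have := ltn_ord i; lia.
  apply: le_trans (le_bigmax _ _ (Ordinal ji)) => /=.
  rewrite (ge0_relu (s0 _)).
  case: (boolP (odd i)) => oi.
    have im := ltn_ord i.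
    have -> : (i./2.*2 < m)%N by lia.
    have -> : inord i./2.*2.+1 = i by apply/val_inj; rewrite /= inordK; lia.
    by rewrite -lerBlDl /relu le_max lexx orbT.
  have -> : inord i./2.*2 = i.
    by apply/val_inj; have im := ltn_ord i; rewrite /= inordK; lia.
  by rewrite lerDl relu_ge0.
Qed.

(** Each value travels as a sum of two nonnegative activations, because one level of the tree
    outputs [relu a] and [relu (b - a)]; the next layer absorbs the addition, so a level costs one
    hidden layer. The scheme is correct for nonnegative activations, and [F] is specified only
    there. *)
Lemma realizes_bigmax (K : finType) (H : (K -> R) -> R) (dp wd nz m : nat) :
  (0 < #|K|)%N ->
  realizes (fun k : 'I_#|{: K * 'I_1 * bool}| => enum_val k)
    (fun v => H (fun k => v (k, ord0, true) + v (k, ord0, false))) dp wd nz ->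
  exists2 F,
    realizes (fun k : 'I_#|{: K * 'I_m.+1 * bool}| => enum_val k) F
      (up_log 2 m.+1 + dp) (maxn (#|K| * m.+1 * 2) wd)
      (#|K| * (7 * m - odd m) + nz)
  & forall v, (forall a, 0 <= v a) ->
      F v = H (fun k =>
        \big[Num.max/0]_(j < m.+1) (v (k, j, true) + v (k, j, false))).
Proof.
move=> K0 HK; have [p] := ubnP m; elim: p m => // p IHp [_|m mp].
  eexists; first by apply: realizes_weaken HK; lia.
  move=> v v0 /=; congr H; apply/funext => k.
  by rewrite big_ord_recl big_ord0 max_l // addr_ge0.
have [|F FN FE] := IHp m.+1./2; first by lia.
(* Neuron [true] holds the even entry of a pair (two weights), neuron [false] the odd entry minus
   the even one (four weights, or an empty row if there is no partner). *)
pose r (a : K * 'I_(m.+1./2).+1 * bool) : seq (R * (K * 'I_m.+2 * bool)) :=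
  let: (k, j, t) := a in
  let pair c i := [:: (c, (k, inord i, true)); (c, (k, inord i, false))] in
  if t then pair 1 j.*2
  else if (j.*2 < m.+1)%N then pair 1 j.*2.+1 ++ pair (-1) j.*2 else [::].
exists (fun v => F (fun j => relu (\sum_(c <- r j) c.1 * v c.2 + 0))).
  have J0 : (0 < #|{: K * 'I_(m.+1./2).+1 * bool}|)%N.
    by rewrite !card_prod !card_ord card_bool !muln_gt0 K0.
  have := realizes_hidden r (fun=> 0) (enum_val_bij _) J0 FN.
  apply: realizes_weaken.
  - by rewrite (up_log2S (ltn0Sn m)).
  - rewrite !card_prod !card_ord card_bool !geq_max !leq_max !leqnn orbT andbT.
    have h : (#|K| * (m.+1)./2.+1 * 2 <= #|K| * m.+2 * 2)%N.
      by rewrite leq_mul2r leq_mul2l; apply/orP; right; apply/orP; right; lia.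
    by rewrite h.
  - rewrite addnA leq_add2r eqxx.
    under eq_bigr do rewrite addn0.
    rewrite sum_prod_bool.
    rewrite (_ : (\sum_a _ = \sum_(k : K) \sum_(j < (m.+1./2).+1)
      (size (r (k, j, true)) + size (r (k, j, false))))%N); last first.
      by rewrite pair_bigA; apply: eq_bigr => -[].
    (* With M = m.+1, the M./2 pairs before the last index take 6 weights each, the last index 2 or
       6 by the parity of M. The correction [- odd] lets the recursion from M to M./2 close, already
       at M = 2. *)
    apply: (@leq_trans (\sum_(k : K) (m.+1./2 * 6 + (2 + 4 * odd m.+1)) +
                        #|K| * (7 * m.+1./2 - odd m.+1./2))).
      rewrite leq_add2r; apply: leq_sum => k _.
      rewrite big_ord_recr /= leq_add //.
        rewrite -[X in (_ <= X * _)%N]card_ord -sum_nat_const.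
        by apply: leq_sum => j _; case: ifP.
      by rewrite leq_add2l; case: ifP => //=; lia.
    by rewrite sum_nat_const -mulnDr leq_mul2l; apply/orP; right; lia.
move=> v v0; rewrite FE; last by move=> a; exact: relu_ge0.
congr H; apply/funext => k.
rewrite -(bigmax_pairs (s := fun j => v (k, j, true) + v (k, j, false))).
  apply: eq_bigr => j _; rewrite !addr0 /r !big_cons !big_nil !mul1r addr0.
  congr (_ + relu _); case: ifP => _; rewrite ?big_cons big_nil //= !mul1r !mulN1r addr0.
  by ring.
by move=> j; rewrite addr_ge0.
Qed.

End Networks.

(** * Averages over random roundings *)

Section Concave.
Variable R : realType.

Lemma concave_functionP (I : set R) (w : R -> R) (t x y : R) :
  concave_function I w -> 0 <= t <= 1 -> I x -> I y ->
  t * w x + (1 - t) * w y <= w (t * x + (1 - t) * y).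
Proof.
move=> cw /andP[t0 t1] Ix Iy.
have : - w (t * x + (1 - t) * y) <= t * - w x + (1 - t) * - w y.
  exact: (cw (Itv01 t0 t1) x y (mem_set Ix) (mem_set Iy)).
by rewrite !mulrN -opprD lerN2.
Qed.

Lemma concave_sum (T : R) (w : R -> R) (N : nat) (p z : 'I_N -> R) :
  concave_function `[0, T] w -> (forall i, 0 <= p i) ->
  (forall i, 0 <= z i <= T) -> \sum_i p i = 1 ->
  \sum_i p i * w (z i) <= w (\sum_i p i * z i).
Proof.
move=> cw p0 zT p1.
(* Initial segments of the weights do not sum to 1, so the induction runs on the form homogeneous in
   the weights. *)
suff : \sum_i p i * w (z i) <=
    (\sum_i p i) * w ((\sum_i p i * z i) / \sum_i p i).
  by rewrite p1 mul1r divr1.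
elim: N p z p0 zT {p1} => [|N IH] p z p0 zT.
  by rewrite !big_ord0 mul0r.
rewrite !big_ord_recr /=.
have {IH} /= := IH (fun i => p (widen_ord (leqnSn N) i))
  (fun i => z (widen_ord (leqnSn N) i)) (fun=> p0 _) (fun=> zT _).
set L := \sum_i _ * w _; set S := \sum_i _ * z _; set P := \sum_i _.
have P0 : 0 <= P by apply: sumr_ge0.
have S0 : 0 <= S.
  by apply: sumr_ge0 => i _; rewrite mulr_ge0 //; case/andP: (zT (widen_ord (leqnSn N) i)).
have ST : S <= P * T.
  rewrite mulr_suml; apply: ler_sum => i _; rewrite ler_wpM2l //.
  by case/andP: (zT (widen_ord (leqnSn N) i)).
move: (p ord_max) (p0 ord_max) (z ord_max) (zT ord_max) => q q0 y yT LP.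
(* If the earlier weights vanish, [S / P] is not a mean and only the last term remains. *)
have [Pz|Pn] := eqVneq P 0.
  have -> : S = 0 by apply/le_anti; rewrite S0 andbT (le_trans ST) // Pz mul0r.
  move: LP; rewrite Pz mul0r !add0r => LP.
  have [->|qn] := eqVneq q 0; first by rewrite !mul0r addr0.
  by rewrite -[(q * y) / q]mulrAC divff // mul1r -[leRHS]add0r lerD2r.
have Pp : 0 < P by rewrite lt_neqAle eq_sym Pn.
have Qp : 0 < P + q by rewrite ltr_wpDr.
(* The new mean combines [S / P] and [y] with weights P / (P + q) and q / (P + q). *)
have h : 0 <= P / (P + q) <= 1.
  by rewrite divr_ge0 ?(ltW Qp) //= ler_pdivrMr // mul1r lerDl.
have := concave_functionP (x := S / P) (y := y) cw h _ _.
have -> : 1 - P / (P + q) = q / (P + q) by field; rewrite gt_eqF.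
have -> : P / (P + q) * (S / P) + q / (P + q) * y = (S + q * y) / (P + q).
  by field; rewrite !gt_eqF.
move=> /(_ _ _)/le_trans.
have -> : P / (P + q) * w (S / P) + q / (P + q) * w y =
   (P * w (S / P) + q * w y) / (P + q) by field; rewrite gt_eqF.
move=> H.
rewrite -ler_pdivrMl // mulrC.
apply: le_trans (H _ _ _ (lexx _)).
- by rewrite ler_pM2r ?invr_gt0 // lerD2r.
- by rewrite /= in_itv /= divr_ge0 //= ler_pdivrMr // mulrC.
- by rewrite /= in_itv.
Qed.

End Concave.

(** * Random rounding with a discretised uniform variable *)

Section Rounding.
Variable R : realType.

(* A finitely supported stand-in, exact on the thresholds of s, for a random
   variable u uniformly distributed on [0, 1]. *)
Definition uniform_on (N : nat) (p u : 'I_N -> R) (s : seq R) :=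
  [/\ forall j, 0 <= p j, forall j, 0 <= u j < 1, \sum_j p j = 1
    & forall c, c \in s -> 0 <= c <= 1 -> \sum_j p j * (c <= u j)%R%:R = 1 - c].

(** Sort the thresholds in [0, 1], with 0 and 1 added, as t_0 < ... < t_N and put mass t_(j+1) - t_j
    at t_j: the mass at or above t_i telescopes to 1 - t_i. The last point, 1, gets no mass, which
    keeps [u] below 1. *)
Lemma uniform_on_exists (s : seq R) :
  exists N (p u : 'I_N -> R), uniform_on p u s.
Proof.
pose t := sort <=%R (undup (0 :: 1 :: [seq c <- s | 0 <= c <= 1])).
have tE c : (c \in t) = [|| c == 0, c == 1 | (0 <= c <= 1) && (c \in s)].
  by rewrite mem_sort mem_undup !inE mem_filter.
have t01 c : c \in t -> 0 <= c <= 1.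
  rewrite tE => /or3P[/eqP->|/eqP->|/andP[]//]; by rewrite lexx ler01.
have ts : sorted <%R t by rewrite sort_lt_sorted undup_uniq.
have [N sN] : exists N, size t = N.+1.
  by case: t tE {t01 ts} => [/(_ 0)|a t' _]; [rewrite eqxx|exists (size t')].
have leE i j : (i <= N)%N -> (j <= N)%N -> (t`_i <= t`_j) = (i <= j)%N.
  by move=> iN jN; rewrite (lt_sorted_leq_nth 0 ts) ?inE ?sN.
have idx c : c \in t -> exists2 i, (i <= N)%N & c = t`_i.
  move=> ct; exists (index c t); last by rewrite nth_index.
  by rewrite -ltnS -sN index_mem.
have tN : t`_N = 1.
  apply/le_anti/andP; split.
    by have /t01/andP[] : t`_N \in t by rewrite mem_nth // sN.
  have [|i iN ->] := idx 1; first by rewrite tE eqxx orbT.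
  by rewrite leE.
have key c : c \in t -> \sum_(j < N) (t`_j.+1 - t`_j) * (c <= t`_j)%R%:R = 1 - c.
  move=> /idx[i iN ->]; rewrite -[X in _ = X - _]tN -telescope_sumr // big_geq_mkord [RHS]big_mkcond /=.
  apply: eq_bigr => j _; rewrite leE // ?(ltnW (ltn_ord j)) //.
  by case: ifP; rewrite ?mulr1 ?mulr0.
exists N, (fun j => t`_j.+1 - t`_j), (fun j => t`_j); split.
- by move=> j; rewrite subr_ge0 leE // ltnW.
- move=> j; have jN := ltn_ord j.
  have /t01/andP[-> _] : t`_j \in t by rewrite mem_nth // sN ltnS ltnW.
  by rewrite /= -tN ltNge leE ?(ltnW jN) // -ltnNge.
- have := key 0; rewrite tE eqxx subr0 => /(_ isT) <-.
  apply: eq_bigr => j _; have jN := ltn_ord j.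
  have /t01/andP[-> _] : t`_j \in t by rewrite mem_nth // sN ltnS ltnW.
  by rewrite mulr1.
- by move=> c cs c01; apply: key; rewrite tE c01 cs !orbT.
Qed.

(** The value of u at which the integer part of a + u increases, for a >= 0. At an integer it is 1,
    so u < 1 leaves integers fixed. *)
Definition jump (a : R) : R := (Num.truncn a).+1%:R - a.

Lemma jump_itv (a : R) : 0 <= a -> 0 <= jump a <= 1.
Proof.
by move=> a0; have := truncn_itv a0; rewrite /jump -natr1; lra.
Qed.

Lemma truncn_addl (a u : R) : 0 <= a -> 0 <= u < 1 ->
  (Num.truncn (a + u))%:R = (Num.truncn a)%:R + (jump a <= u)%R%:R :> R.
Proof.
move=> a0 u01; rewrite -natrD; congr (_%:R); apply: truncn_def.
have := truncn_itv a0; rewrite /jump -!natr1 natrD.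
by case: (lerP _ u) => /= h; lra.
Qed.

Section Expectation.
Variables (N : nat) (p u : 'I_N -> R) (s : seq R).
Hypothesis pus : uniform_on p u s.

Lemma expect_truncn (a : R) : 0 <= a -> jump a \in s ->
  \sum_j p j * (Num.truncn (a + u j))%:R = a.
Proof.
case: pus => p0 u01 p1 us a0 /us/(_ (jump_itv a0)) E.
under eq_bigr do rewrite truncn_addl // mulrDr.
by rewrite big_split /= -mulr_suml p1 E /jump -natr1; ring.
Qed.

(** Both numbers are rounded with the same u and rounding is monotone, so the difference has
    constant sign and the absolute value leaves the mean. *)
Lemma expect_truncn_dist (a b : R) : 0 <= a -> 0 <= b ->
  jump a \in s -> jump b \in s ->
  \sum_j p j * `|(Num.truncn (a + u j))%:R - (Num.truncn (b + u j))%:R|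
  = `|a - b|.
Proof.
wlog ab : a b / a <= b.
  move=> H a0 b0 sa sb; case: (leP a b) => [|/ltW] ab; first exact: H.
  by rewrite distrC -H //; apply: eq_bigr => j _; rewrite distrC.
move=> a0 b0 sa sb.
rewrite distrC ger0_norm ?subr_ge0 //.
rewrite -[in RHS](expect_truncn a0 sa) -[in RHS](expect_truncn b0 sb) -sumrB.
apply: eq_bigr => j _; rewrite distrC ger0_norm ?mulrBr //.
by rewrite subr_ge0 ler_nat le_truncn // lerD2r.
Qed.

(* With t the fractional part of a, the mean distance is 2t(1 - t). *)
Lemma expect_truncn_err (a : R) : 0 <= a -> jump a \in s ->
  \sum_j p j * `|(Num.truncn (a + u j))%:R - a| <= 2^-1.
Proof.
case: pus => p0 u01 p1 us a0 /us/(_ (jump_itv a0)) E.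
pose t := a - (Num.truncn a)%:R.
have t01 : 0 <= t < 1 by have := truncn_itv a0; rewrite /t -natr1; lra.
have JE : jump a = 1 - t by rewrite /jump /t -natr1; ring.
(* The indicator takes the values 0 and 1, so its distance to t is affine in it. *)
apply: (@le_trans _ _
  (\sum_j (p j * t + (1 - 2 * t) * (p j * (jump a <= u j)%R%:R)))).
  rewrite le_eqVlt; apply/orP; left; apply/eqP/eq_bigr => j _; rewrite truncn_addl //.
  rewrite (_ : _ + _ - a = (jump a <= u j)%R%:R - t); last by rewrite /t; ring.
  case: (jump a <= u j) => /=; first by rewrite ger0_norm; [ring|lra].
  by rewrite sub0r normrN ger0_norm; [ring|lra].
rewrite big_split /= -mulr_suml -mulr_sumr p1 E JE.
have : 0 <= (2 * t - 1) ^+ 2 by rewrite sqr_ge0.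
by rewrite expr2; lra.
Qed.

End Expectation.
End Rounding.

(** * Kuhn interpolation *)

Section Interpolation.
Variables (R : realType) (d n : nat).
Hypothesis n_gt0 : (0 < n)%N.

Local Notation grid := {ffun 'I_d -> 'I_n.+1}.

Definition gridpt (g : grid) : 'cV[R]_d := \col_k ((g k)%:R / n%:R).

Definition excess (x : 'cV[R]_d) (g : grid) : R :=
  \big[Num.max/0]_(k < d) relu (n%:R * x k ord0 - (g k)%:R).

Definition deficit (x : 'cV[R]_d) (g : grid) : R :=
  \big[Num.max/0]_(k < d) relu ((g k)%:R - n%:R * x k ord0).

(* The nodal basis function at g of the Kuhn (Freudenthal) triangulation. *)
Definition hat (x : 'cV[R]_d) (g : grid) : R := relu (1 - excess x g - deficit x g).

Definition interpolant (f : 'cV[R]_d -> R) (x : 'cV[R]_d) : R :=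
  \sum_g f (gridpt g) * hat x g.

(** For x in the cube and 0 <= u < 1 the integer part is at most n, so [inord] never returns its
    default. *)
Definition round (x : 'cV[R]_d) (u : R) : grid :=
  [ffun k => inord (Num.truncn (n%:R * x k ord0 + u))].

(** The levels at which the law of u has to be exact: jumps for the coordinate means, the rest as
    endpoints of the interval of u rounding x to a given grid point. *)
Definition thresholds (x : 'cV[R]_d) : seq R :=
  [seq jump (n%:R * x k ord0) | k : 'I_d] ++
  [seq deficit x g | g : grid] ++ [seq 1 - excess x g | g : grid].

Lemma gridpt_cube g : unit_cube R d (gridpt g).
Proof.
move=> k; rewrite mxE divr_ge0 //= ler_pdivrMr ?ltr0n // mul1r ler_nat.
by rewrite -ltnS.
Qed.

(** * The law of the rounded point *)

Section Point.
Variable x : 'cV[R]_d.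
Hypothesis xQ : unit_cube R d x.

Lemma scaled_ge0 k : 0 <= n%:R * x k ord0.
Proof. by case/andP: (xQ k) => x0 _; rewrite mulr_ge0. Qed.

Lemma roundE u k : 0 <= u < 1 ->
  round x u k = Num.truncn (n%:R * x k ord0 + u) :> nat.
Proof.
case/andP=> u0 u1; rewrite ffunE inordK // truncn_lt_nat.
  rewrite -natr1 ler_ltD //; case/andP: (xQ k) => _ x1.
  by rewrite ler_piMr.
by rewrite addr_ge0 // scaled_ge0.
Qed.

Lemma jump_thresholds k : jump (n%:R * x k ord0) \in thresholds x.
Proof. by rewrite mem_cat fintype.image_f. Qed.

(** Coordinate k is rounded to g_k iff g_k - n x_k <= u < 1 - (n x_k - g_k); intersect over k.
    Truncating both maxima at 0 is harmless as 0 <= u < 1. *)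
Lemma round_eq u g : 0 <= u < 1 ->
  (round x u == g) = (deficit x g <= u < 1 - excess x g).
Proof.
move=> /[dup] u01 /andP[u0 u1].
have hk k : (round x u k == g k) = ((g k)%:R <= n%:R * x k ord0 + u < (g k)%:R + 1).
  by rewrite -val_eqE /= roundE // truncn_eq ?addr_ge0 ?scaled_ge0 // natr1.
apply/eqP/andP => [E|[/bigmax_leP[_ lo]]].
  split.
    apply/bigmax_leP; split=> // k _; rewrite /relu ge_max u0 /=.
    by have := hk k; rewrite E eqxx => /esym/andP[]; lra.
  rewrite ltrBrDr -ltrBrDl; apply/bigmax_ltP; split; first by rewrite subr_gt0.
  move=> k _; rewrite /relu gt_max subr_gt0 u1 /=.
  by have := hk k; rewrite E eqxx => /esym/andP[]; lra.
rewrite ltrBrDr -ltrBrDl => /bigmax_ltP[_ hi].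
apply/ffunP => k; apply/eqP; rewrite hk.
have := lo k isT; rewrite /relu ge_max => /andP[_ l].
have := hi k isT; rewrite /relu gt_max => /andP[_ h].
by apply/andP; split; lra.
Qed.

Variables (N : nat) (p u : 'I_N -> R) (s : seq R).
Hypothesis pus : uniform_on p u s.
Hypothesis xs : {subset thresholds x <= s}.

(** The probability of the interval in [round_eq] is its length, or 0 if it is empty. *)
Lemma expect_round g : \sum_j p j * (round x (u j) == g)%:R = hat x g.
Proof.
case: pus => p0 u01 p1 us.
have un0 : 0 <= deficit x g by exact: bigmax_ge_id.
have ov0 : 0 <= excess x g by exact: bigmax_ge_id.
have uns : deficit x g \in s.
  by apply: xs; rewrite !mem_cat fintype.image_f ?orbT.
have ovs : 1 - excess x g \in s.
  by apply: xs; rewrite !mem_cat [X in [|| _, _ | X]]fintype.image_f ?orbT.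
rewrite /hat; case: (lerP (deficit x g) (1 - excess x g)) => h.
  rewrite ge0_relu; last by lra.
  have -> : 1 - excess x g - deficit x g = (1 - deficit x g) - (1 - (1 - excess x g)).
    by ring.
  rewrite -(us _ uns) -?(us _ ovs); try by apply/andP; split; lra.
  rewrite -sumrB; apply: eq_bigr => j _; rewrite -mulrBr round_eq //.
  congr (_ * _); case: (lerP (1 - excess x g) (u j)) => b.
    by rewrite (le_trans h b) subrr.
  by rewrite andbT subr0.
rewrite le0_relu; last by lra.
apply: big1 => j _; rewrite round_eq //.
case: andP => [[a b]|]; last by rewrite mulr0.
by have := lt_trans (le_lt_trans a b) h; rewrite ltxx.
Qed.

(** Any law exact at the thresholds of x serves, so two points can share one u. *)
Lemma interpolantE f :
  interpolant f x = \sum_j p j * f (gridpt (round x (u j))).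
Proof.
rewrite /interpolant; under eq_bigr do rewrite -expect_round mulr_sumr.
rewrite exchange_big /=; apply: eq_bigr => j _.
rewrite (bigD1 (round x (u j))) //= eqxx mulr1 big1 ?addr0; first exact: mulrC.
by move=> g; rewrite eq_sym => /negbTE ->; rewrite !mulr0.
Qed.

End Point.

Lemma norm1_cube (x y : 'cV[R]_d) : unit_cube R d x -> unit_cube R d y ->
  0 <= norm1 (x - y) <= d%:R.
Proof.
move=> xQ yQ; rewrite sumr_ge0 //= -[leRHS]mulr1 mulr_natl -[X in _ *+ X]card_ord.
rewrite -sumr_const; apply: ler_sum => k _; rewrite !mxE ler_norml.
by have := xQ k; have := yQ k; lra.
Qed.

(** * Regularity and error of the interpolant *)

Section Modulus.
Variables (w : R -> R) (f : 'cV[R]_d -> R).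
Hypothesis fw : modulus_of_regularity `[0, d%:R] w (unit_cube R d) f.

(** Jensen's inequality for [w] along the coupling of [y j] and [z j]; monotonicity then raises the
    mean distance to [t], and t <= d stays in the domain of [w]. *)
Lemma modulus_mean (N : nat) (p : 'I_N -> R) (y z : 'I_N -> 'cV[R]_d) (t : R) :
  (forall j, 0 <= p j) -> \sum_j p j = 1 ->
  (forall j, unit_cube R d (y j)) -> (forall j, unit_cube R d (z j)) ->
  \sum_j p j * norm1 (y j - z j) <= t -> t <= d%:R ->
  `|\sum_j p j * f (y j) - \sum_j p j * f (z j)| <= w t.
Proof.
case: fw => -[_ _ wmono wconc] fmod p0 p1 yQ zQ yzt td.
have m0 : 0 <= \sum_j p j * norm1 (y j - z j).
  by apply: sumr_ge0 => j _; rewrite mulr_ge0 //; case/andP: (norm1_cube (yQ j) (zQ j)).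
apply: (@le_trans _ _ (w (\sum_j p j * norm1 (y j - z j)))); last first.
  by apply: wmono => //=; rewrite in_itv /= ?(le_trans m0 yzt) // m0 (le_trans yzt).
apply: le_trans (concave_sum wconc p0 (fun j => norm1_cube (yQ j) (zQ j)) p1).
rewrite -sumrB; apply: le_trans (ler_norm_sum _ _ _) _; apply: ler_sum => j _.
by rewrite -mulrBr normrM ger0_norm // ler_wpM2l // fmod.
Qed.

Lemma interpolant_modulus x y : unit_cube R d x -> unit_cube R d y ->
  `|interpolant f x - interpolant f y| <= w (norm1 (x - y)).
Proof.
move=> xQ yQ.
have [N [p [u pu]]] := uniform_on_exists (thresholds x ++ thresholds y).
have xs : {subset thresholds x <= thresholds x ++ thresholds y}.
  by move=> c cx; rewrite mem_cat cx.
have ys : {subset thresholds y <= thresholds x ++ thresholds y}.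
  by move=> c cy; rewrite mem_cat cy orbT.
rewrite (interpolantE xQ pu xs) (interpolantE yQ pu ys).
case: (pu) => p0 u01 p1 _.
have n0 : 0 < n%:R :> R by rewrite ltr0n.
apply: modulus_mean => //; try by move=> j; exact: gridpt_cube.
  (* After exchanging the sums, coordinate k contributes exactly |x_k - y_k|. *)
  under eq_bigr do rewrite mulr_sumr.
  rewrite exchange_big /=; apply: ler_sum => k _.
  have := expect_truncn_dist pu (scaled_ge0 xQ k) (scaled_ge0 yQ k)
    (xs _ (jump_thresholds x k)) (ys _ (jump_thresholds y k)).
  rewrite -mulrBr normrM gtr0_norm // => E.
  rewrite !mxE -(ler_pM2l n0) -E mulr_sumr; apply: ler_sum => j _.
  rewrite !mxE -mulrBl normrM [`|_^-1|]gtr0_norm ?invr_gt0 // !roundE //.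
  by rewrite le_eqVlt; apply/orP; left; apply/eqP; field; rewrite gt_eqF.
by case/andP: (norm1_cube xQ yQ).
Qed.

Lemma interpolant_error x : unit_cube R d x ->
  `|f x - interpolant f x| <= w (d%:R / (2 * n%:R)).
Proof.
move=> xQ.
have [N [p [u pu]]] := uniform_on_exists (thresholds x).
rewrite (interpolantE xQ pu) // distrC.
case: (pu) => p0 u01 p1 _.
(* As a mean of constants, f x fits the coupling of [modulus_mean]; each coordinate then has mean
   error at most 1/(2n). *)
have -> : f x = \sum_j p j * f x by rewrite -mulr_suml p1 mul1r.
have n0 : 0 < n%:R :> R by rewrite ltr0n.
apply: modulus_mean => //; first by move=> j; exact: gridpt_cube.
  under eq_bigr do rewrite mulr_sumr.
  rewrite exchange_big /= -[X in X / _]mulr1 mulr_natl -[X in _ *+ X]card_ord.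
  rewrite -sumr_const mulr_suml; apply: ler_sum => k _.
  have := expect_truncn_err pu (scaled_ge0 xQ k) (jump_thresholds x k) => E.
  rewrite invfM mul1r -ler_pdivrMr ?invr_gt0 // invrK; apply: le_trans E.
  rewrite mulr_suml; apply: ler_sum => j _.
  rewrite !mxE -mulrA ler_wpM2l // -[X in _ * X]gtr0_norm // -normrM.
  rewrite le_eqVlt; apply/orP; left; apply/eqP; rewrite roundE //; congr (`|_|).
  by field; rewrite gt_eqF.
rewrite ler_pdivrMr ?mulr_gt0 // ler_peMr // -natrM ler1n.
by rewrite muln_gt0.
Qed.

End Modulus.
End Interpolation.

(** * Extension of the modulus and bounds on the essential supremum *)

Section Extension.
Variable R : realType.

Lemma extend_modulusE (T : R) (w : R -> R) t :
  extend_modulus T w t = w (Num.min t T).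
Proof. by rewrite /extend_modulus; case: leP => // /ltW h; rewrite min_r. Qed.

(** The extension is [w] after t -> min(t, T), a composition of increasing concave functions. *)
Lemma extend_is_modulus (T : R) (w : R -> R) : 0 <= T ->
  is_modulus `[0, T] w -> is_modulus `[0, +oo[ (extend_modulus T w).
Proof.
move=> T0 [w0 wge wmono wconc].
have I t : 0 <= t -> [set` `[0, T]] (Num.min t T).
  by move=> t0; rewrite /= in_itv /= le_min t0 T0 ge_min lexx orbT.
split.
- by rewrite extend_modulusE min_l.
- by move=> t; rewrite /= in_itv /= andbT extend_modulusE => /I/wge.
- move=> s t; rewrite /= !in_itv /= !andbT !extend_modulusE => s0 t0 st.
  by apply: wmono; [exact: I|exact: I|rewrite le_min !ge_min st lexx !orbT].
- move=> t x y; rewrite !inE /= !in_itv /= !andbT => x0 y0.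
  have t0 : 0 <= t%:num by [].
  have t1 : t%:num <= 1 by [].
  rewrite -[leRHS]/(t%:num * - extend_modulus T w x +
    (1 - t%:num) * - extend_modulus T w y).
  rewrite -[X in extend_modulus T w X]/(t%:num * x + (1 - t%:num) * y).
  rewrite !mulrN -opprD lerN2 !extend_modulusE.
  apply: le_trans (concave_functionP wconc _ (I _ x0) (I _ y0)) _.
    by rewrite t0.
  have h z : Num.min z T <= z by rewrite ge_min lexx.
  have h' z : Num.min z T <= T by rewrite ge_min lexx orbT.
  have t1' : 0 <= 1 - t%:num by rewrite subr_ge0.
  (* Concavity of min(., T): the combination of truncated arguments is at most the truncated
     combination. *)
  apply: wmono.
  + have := I _ x0; have := I _ y0; rewrite /= !in_itv /=.
    move=> /andP[a b] /andP[a' b']; rewrite addr_ge0 ?mulr_ge0 //=.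
    apply: (@le_trans _ _ (t%:num * T + (1 - t%:num) * T)).
      by rewrite lerD // ler_wpM2l.
    by rewrite -mulrDl addrC subrK mul1r.
  + by apply: I; rewrite addr_ge0 ?mulr_ge0.
  + rewrite le_min; apply/andP; split.
      by rewrite lerD // ler_wpM2l.
    apply: (@le_trans _ _ (t%:num * T + (1 - t%:num) * T)).
      by rewrite lerD // ler_wpM2l.
    by rewrite -mulrDl addrC subrK mul1r.
Qed.

(** The exceptional set is empty and is covered by degenerate boxes at the origin; their volume is 0
    because d > 0 gives the product a vanishing side. *)
Lemma Linfty_norm_le d (O : set 'cV[R]_d) (g : 'cV[R]_d -> R) (C : R) :
  (0 < d)%N -> 0 <= C -> (forall x, O x -> `|g x| <= C) ->
  (Linfty_norm O g <= C%:E)%E.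
Proof.
move=> d0 C0 gC; apply: ereal_inf_lbound; exists C => //; split=> //.
rewrite /ae_on (_ : _ `&` _ = set0); last first.
  by rewrite -subset0 => x /= [/gC].
have box0 (a b : 'cV[R]_d) : 0 <= box_volume a b.
  by apply: prodr_ge0 => i _; rewrite le_max lexx.
apply/le_anti/andP; split.
  apply: ereal_inf_lbound; exists (fun=> 0), (fun=> 0); split; first exact: sub0set.
  rewrite eseries0 // => k _ _; congr (_%:E).
  by rewrite /box_volume (bigD1 (Ordinal d0)) //= mxE subrr maxxx mul0r.
apply/ereal_infP => _ [a [b [_ ->]]].
by apply: nneseries_ge0 => k _ _; rewrite lee_fin.
Qed.

End Extension.

(** * The clipped interpolant as a network *)

Section Clip.
Variables (R : realType) (d : nat).

(** Coordinatewise max(0, min(1, x_k)), written as two hidden layers with weight -1 and bias 1. *)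
Definition clip (x : 'cV[R]_d) : 'cV[R]_d :=
  \col_k relu (1 - relu (1 - x k ord0)).

Lemma clip_cube x : unit_cube R d (clip x).
Proof.
move=> k; rewrite mxE relu_ge0 /= /relu ge_max ler01 /=.
by rewrite gerBl le_max lexx.
Qed.

Lemma clip_id x : unit_cube R d x -> clip x = x.
Proof.
move=> xQ; apply/matrixP => k l; rewrite ord1 mxE; case/andP: (xQ k) => x0 x1.
by rewrite [relu (1 - x _ _)]ge0_relu ?subr_ge0 // subKr ge0_relu.
Qed.

Lemma relu_lipschitz (s t : R) : `|relu s - relu t| <= `|s - t|.
Proof.
rewrite /relu; case: (lerP 0 s) => s0; case: (lerP 0 t) => t0;
  rewrite ?subr0 ?sub0r ?normrN ?oppr0 ?normr0 ?normr_ge0 //.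
- by rewrite ger0_norm // ger0_norm; lra.
- by rewrite ger0_norm // ler0_norm; lra.
Qed.

Lemma clip_norm1 x y : norm1 (clip x - clip y) <= norm1 (x - y).
Proof.
apply: ler_sum => k _; rewrite !mxE.
apply: le_trans (relu_lipschitz _ _) _.
rewrite (_ : _ - _ = - (relu (1 - x k ord0) - relu (1 - y k ord0))); last by ring.
rewrite normrN; apply: le_trans (relu_lipschitz _ _) _.
by rewrite -normrN opprB (_ : _ - _ = x k ord0 - y k ord0) //; ring.
Qed.

End Clip.

(** From the input on: two clipping layers, the positive parts of n x_k - g_k and g_k - n x_k, the
    trees of maxima, the hat functions, the linear output; the proof composes them from the output
    back. With D = d.+1 and G = (n + 1)^D the nonzero parameters number at most 4D + 4GD + 14G(D -
    1) + 5G + G. *)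
Lemma interpolant_realized (R : realType) (d n : nat) (f : 'cV[R]_d.+1 -> R) :
  (0 < n)%N ->
  exists N : relu_mlp R d.+1 1,
    [/\ (mlp_width N <= 8 * d.+1 * (n + 1) ^ d.+1)%N,
        (mlp_depth N <= up_log 2 d.+1 + 5)%N,
        (mlp_nonzeros N <= 18 * d.+1 * (n + 1) ^ d.+1)%N
      & forall x, mlp_fun N x = interpolant n f (clip x)].
Proof.
move=> n0.
pose G := {ffun 'I_d.+1 -> 'I_n.+1}.
have cG : #|{: G}| = ((n + 1) ^ d.+1)%N by rewrite card_ffun !card_ord addn1.
have G0 : (0 < #|{: G}|)%N by rewrite cG addn1 expn_gt0.
pose a (g : G) := f (gridpt R g).
pose H (h : G * bool -> R) :=
  \sum_g a g * relu (1 - h (g, true) - h (g, false)).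
(* Excess ([true]) and deficit ([false]) each arrive as two summands, hence four weights -1. *)
pose rH (g : G) : seq (R * (G * bool * 'I_1 * bool)) :=
  [seq (-1, (g, c.1, ord0, c.2)) | c <- [:: (true, true); (true, false); (false, true); (false, false)]].
have NH := realizes_hidden rH (fun=> 1) (enum_val_bij _) G0
  (realizes_linear a (enum_val_bij _)).
have EH : (fun v => \sum_g a g *
     relu (\sum_(c <- rH g) c.1 * v c.2 + 1)) =
   (fun v => H (fun k => v (k, ord0, true) + v (k, ord0, false))).
  apply/funext => v; apply: eq_bigr => g _; congr (_ * relu _).
  by rewrite !big_cons big_nil /=; ring.
rewrite EH in NH.
have K0 : (0 < #|{: G * bool}|)%N by rewrite card_prod card_bool muln_gt0 G0.
have [F NF FE] := realizes_bigmax d K0 NH.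
(* Neurons with [t] false are identically 0: they pad each positive part to the pair of summands
   that the tree expects. *)
pose rL (c : G * bool * 'I_d.+1 * bool) : seq (R * 'I_d.+1) :=
  let: (g, s, k, t) := c in
  if t then [:: (if s then n%:R else - n%:R, k)] else [::].
pose bL (c : G * bool * 'I_d.+1 * bool) : R :=
  let: (g, s, k, t) := c in
  if t then if s then - (g k)%:R else (g k)%:R else 0.
have L0 : (0 < #|{: G * bool * 'I_d.+1 * bool}|)%N.
  by rewrite !card_prod card_ord !card_bool !muln_gt0 G0.
have I0 : (0 < #|'I_d.+1|)%N by rewrite card_ord.
pose rC (k : 'I_d.+1) : seq (R * 'I_d.+1) := [:: (-1, k)].
have NL := realizes_hidden rL bL (enum_val_bij _) L0 NF.
have NC := realizes_hidden rC (fun=> 1) (enum_val_bij _) I0 NL.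
have idb : bijective (@id 'I_d.+1) by exists id.
have [N [Nd Nw Nn NE]] := realizes_hidden rC (fun=> 1) idb I0 NC.
exists N; split.
- apply: leq_trans Nw _; rewrite !card_prod !card_ord !card_bool !geq_max -cG.
  rewrite leq0n andbT; move: {+}G0; move: (#|{: G}|) => g g0.
  by do !(apply/andP; split); nia.
- by apply: leq_trans Nd _; lia.
- apply: leq_trans Nn _.
  rewrite !sum_nat_const /= !card_ord.
  have -> : (\sum_j (size (rH j) + (1%R != 0%R :> R)) = 5 * #|{: G}|)%N.
    rewrite (eq_bigr (fun=> 5%N)) ?sum_nat_const ?(mulnC 5) // => j _.
    by rewrite oner_eq0.
  have hL : (\sum_c (size (rL c) + (bL c != 0%R)) <= 2 * (#|{: G}| * 2 * d.+1))%N.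
    rewrite sum_prod_bool.
    apply: (@leq_trans (\sum_(b : G * bool * 'I_d.+1) 2)).
      by apply: leq_sum => -[[g s] k] _ /=; rewrite eqxx !addn0 add1n ltnS leq_b1.
    by rewrite sum_nat_const !card_prod card_bool card_ord mulnC.
  (* The 4D weights and biases of the clipping layers fit into the slack 8G, since D < 2^D <= G for
     n >= 1. *)
  have h2 : (d.+1 < 2 ^ d.+1)%N by exact: ltn_expl.
  have h3 : (2 ^ d.+1 <= #|{: G}|)%N by rewrite cG leq_exp2r // addn1 ltnS.
  rewrite oner_eq0 card_prod card_bool -cG /=.
  move: hL h2 h3; set S := (\sum_c _)%N; move: S (#|{: G}|) => S g hL h2 h3.
  by nia.
- move=> x.
  have -> : x = \col_k x k ord0 by apply/matrixP => k l; rewrite ord1 mxE.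
  rewrite (NE (fun k => x k ord0)) FE; last by move=> c; exact: relu_ge0.
  apply: eq_bigr => g _; rewrite /hat /excess /deficit; congr (_ * relu (1 - _ - _)).
    apply: eq_bigr => k _; rewrite /rL /rC !big_cons !big_nil !mxE /=.
    by rewrite !addr0 (le0_relu (lexx 0)) addr0 !mulN1r ![_ + 1]addrC.
  apply: eq_bigr => k _; rewrite /rL /rC !big_cons !big_nil !mxE /=.
  rewrite !addr0 (le0_relu (lexx 0)) addr0 !mulN1r ![_ + 1]addrC.
  by rewrite mulNr [- _ + _]addrC.
Qed.

(* [up_log 2 d] is the ceiling of the base-2 logarithm of d. *)
Theorem corollary5p1 (R : realType) (d : nat) (d_gt0 : (0 < d)%N)
    (n : nat) (n_gt0 : (0 < n)%N) (f : 'cV[R]_d -> R) (w : R -> R)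
    (fw : modulus_of_regularity `[0, d%:R] w (unit_cube R d) f) :
  exists N : relu_mlp R d 1,
    [/\ (mlp_width N <= 8 * d * (n + 1) ^ d)%N,
        (mlp_depth N <= up_log 2 d + 5)%N,
        (mlp_nonzeros N <= 18 * d * (n + 1) ^ d)%N,
        (Linfty_norm (unit_cube R d) (fun x => (f x - mlp_fun N x)%R)
          <= (w (d%:R / (2 * n%:R)))%:E)%E
      & modulus_of_regularity `[0, +oo[ (extend_modulus d%:R w) setT
          (mlp_fun N)].
Proof.
case: d d_gt0 f fw => // d _ f fw.
have [N [Nw Nd Nn NE]] := interpolant_realized f n_gt0.
exists N; split=> //.
  have err x : unit_cube R d.+1 x ->
      `|f x - mlp_fun N x| <= w (d.+1%:R / (2 * n%:R)).
    by move=> xQ; rewrite NE clip_id //; exact: (interpolant_error n_gt0 fw).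
  apply: Linfty_norm_le => //.
  (* The bound is nonnegative by the error estimate at the origin. *)
  by apply: le_trans (err 0 _) => // k; rewrite mxE lexx ler01.
case: (fw) => mw _.
split; first exact: extend_is_modulus.
move=> x y _ _; rewrite !NE extend_modulusE.
have xQ := clip_cube x; have yQ := clip_cube y.
apply: le_trans (interpolant_modulus n_gt0 fw xQ yQ) _.
have /andP[h0 hd] := norm1_cube xQ yQ.
have xy := clip_norm1 x y.
(* The distance of the clipped points is at most both |x - y|_1 and the dimension, hence at most
   their minimum. *)
apply: (modulus_mono mw); rewrite /= ?in_itv /= ?h0 //.
  by rewrite le_min (le_trans h0 xy) ler0n /= ge_min lexx orbT.
by rewrite le_min xy.
Qed.
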